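(* Let $N,s,k$ be positive integers with $s \le N$ and $k > s$, and let $\mu$ be any compactly supported finite Borel measure on $\Sigma_s$. Then almost every linear map $L\colon \mathbb{R}^N \to \mathbb{R}^k$ is injective on a set of full $\mu$-measure with an inverse which is pointwise $\alpha$-Hölder for every $\alpha \in (0,1)$. Consequently, for almost every linear map $L\colon \mathbb{R}^N\to\mathbb{R}^k$, every $\varepsilon > 0$ and every $\alpha \in (0,1)$, there exists an $\alpha$-Hölder map $g\colon \mathbb{R}^k \to \mathbb{R}^N$ such that $\mu(\{x \in \mathbb{R}^N : g(Lx) \neq x\}) \le \varepsilon$.
   Context: $\Sigma_s = \{x=(x_1,\ldots,x_N)\in\mathbb{R}^N : \text{at most } s \text{ of the } x_i \text{ are non-zero}\}$ is the set of $s$-sparse vectors in $\mathbb{R}^N$. ''Almost every linear map'' refers to the Lebesgue measure on $\mathrm{Lin}(\mathbb{R}^N,\mathbb{R}^k)\simeq\mathbb{R}^{Nk}$. A map $\psi\colon A \to \mathbb{R}^N$, $A\subset\mathbb{R}^k$, is pointwise $\alpha$-Hölder if for every $x \in A$ there exists $c_x > 0$ such that $\|\psi(x)-\psi(y)\| \le c_x\|x-y\|^\alpha$ for every $y \in A$; it is $\alpha$-Hölder if the constant can be chosen independently of $x$. The inverse of $L$ restricted to the full-measure set $X_L$ is the map $(L|_{X_L})^{-1}\colon L(X_L)\to X_L$. *)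

(* Defs.v *)
From HB Require Import structures.
From mathcomp Require Import all_boot all_order all_algebra.
From mathcomp Require Import all_classical all_reals all_analysis.

Set Implicit Arguments.
Unset Strict Implicit.
Unset Printing Implicit Defensive.

Import Order.TTheory GRing.Theory Num.Theory.
Import numFieldNormedType.Exports.

Local Open Scope classical_set_scope.
Local Open Scope ring_scope.

Section lebesgue_tuple.
Context {R : realType}.
Local Notation RB := (measurableTypeR R).

Definition tuple_cons n (z : RB * n.-tuple RB) : n.+1.-tuple RB :=
  [tuple of z.1 :: z.2].

Definition tuple_uncons n (t : n.+1.-tuple RB) : RB * n.-tuple RB :=
  (thead t, [tuple of behead t]).

Lemma tuple_consK n : cancel (@tuple_cons n) (@tuple_uncons n).
Proof.
by move=> [x t]; rewrite /tuple_uncons/= theadE; congr pair; exact/val_inj.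
Qed.

Lemma measurable_tuple_cons n : measurable_fun setT (@tuple_cons n).
Proof. exact: measurable_cons. Qed.

Lemma measurable_tuple_uncons n : measurable_fun setT (@tuple_uncons n).
Proof.
apply/measurable_fun_pair; last exact: measurable_behead.
exact: measurable_tnth.
Qed.

Section step.
Variables (n : nat) (m : {sigma_finite_measure set (n.-tuple RB) -> \bar R}).

Definition lebesgue_tuple_step : set (n.+1.-tuple RB) -> \bar R :=
  pushforward (lebesgue_measure \x m)%E (@tuple_cons n).

Let mcons := @measurable_tuple_cons n.

Let lebesgue_tuple_step0 : lebesgue_tuple_step set0 = 0%E.
Proof. exact: measure0. Qed.

Let lebesgue_tuple_step_ge0 A : (0 <= lebesgue_tuple_step A)%E.
Proof. exact: measure_ge0. Qed.

Let lebesgue_tuple_step_sigma_additive :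
  semi_sigma_additive lebesgue_tuple_step.
Proof. exact: measure_semi_sigma_additive. Qed.

HB.instance Definition _ := isMeasure.Build _ _ _ lebesgue_tuple_step
  lebesgue_tuple_step0 lebesgue_tuple_step_ge0
  lebesgue_tuple_step_sigma_additive.

Let lebesgue_tuple_step_sigma_finite : sigma_finite setT lebesgue_tuple_step.
Proof.
have /sigma_finiteP[F [TF ndF Foo]] := sigma_finiteT (@lebesgue_measure R).
have /sigma_finiteP[G [TG ndG Goo]] := sigma_finiteT m.
exists (fun i => @tuple_uncons n @^-1` (F i `*` G i)).
  rewrite predeqE => t; split=> // _.
  have : setT (thead t) by []; rewrite TF => -[i _ Fi].
  have : setT [tuple of behead t] by []; rewrite TG => -[j _ Gj].
  exists (maxn i j) => //; split => /=.
    by move: Fi; exact/subsetPset/ndF/leq_maxl.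
  by move: Gj; exact/subsetPset/ndG/leq_maxr.
move=> i; have [mF Fi] := Foo i; have [mG Gi] := Goo i; split.
  rewrite -[X in measurable X]setTI.
  by apply: measurable_tuple_uncons => //; exact: measurableX.
rewrite /lebesgue_tuple_step /pushforward -comp_preimage.
rewrite (_ : _ \o _ = id); last by apply/funext => z; exact: tuple_consK.
by rewrite product_measure1E// lte_mul_pinfty// ge0_fin_numE.
Qed.

HB.instance Definition _ := Measure_isSigmaFinite.Build _ _ _
  lebesgue_tuple_step lebesgue_tuple_step_sigma_finite.

End step.

Fixpoint lebesgue_tuple n :
    {sigma_finite_measure set (n.-tuple RB) -> \bar R} :=
  if n is m.+1 then lebesgue_tuple_step (lebesgue_tuple m) else dirac [tuple].

Lemma lebesgue_tuple_box n (A : 'I_n -> set RB) :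
  (forall i, measurable (A i)) ->
  lebesgue_tuple n [set t | forall i, A i (tnth t i)] =
  (\prod_(i < n) lebesgue_measure (A i))%E.
Proof.
elim: n A => [|n IH] A mA.
  rewrite big_ord0 /= diracE mem_set//=.
  by case.
rewrite big_ord_recl -IH//= /lebesgue_tuple_step /pushforward.
rewrite -product_measure1E//; last first.
  rewrite (_ : [set _ | _] = \bigcap_(i in [set: 'I_n])
      ((@tnth n RB ^~ i) @^-1` A (lift ord0 i))); last first.
    by apply/seteqP; split=> [t At i _|t At i]; [exact: At|exact: (At i)].
  apply: fin_bigcap_measurable => // i _.
  rewrite -[X in measurable X]setTI.
  exact: (@measurable_tnth _ RB n i).
congr (product_measure1 _ _ _).
apply/seteqP; split=> [[x t] /= At|[x t] /= [Ax At] i].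
  split; first exact: (At ord0).
  by move=> i; have := At (lift ord0 i); rewrite tnthS.
by case: (unliftP ord0 i) => [j ->|->]; rewrite ?tnthS.
Qed.

End lebesgue_tuple.

(* A linear map from R^N to R^k is represented by its N x k matrix L acting on
   row vectors by x |-> x *m L; the N * k coordinates are its entries. *)
Definition lin_of_coords (R : realType) (N k : nat)
    (v : (N * k).-tuple (measurableTypeR R)) : 'M[R]_(N, k) :=
  vec_mx (\row_i tnth v i).

Definition ae_linear (R : realType) (N k : nat) (P : 'M[R]_(N, k) -> Prop) :=
  {ae lebesgue_tuple (N * k), forall v, P (lin_of_coords v)}.

Notation borel_rV R n := (g_sigma_algebraType (@open 'rV[R]_n)).

Definition measure_support (R : realType) (n : nat)
    (mu : set (borel_rV R n) -> \bar R) : set 'rV[R]_n :=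
  [set x | forall U : set 'rV[R]_n, open_nbhs x U -> (0 < mu U)%E].

Definition sparse (R : realType) (N s : nat) : set 'rV[R]_N :=
  [set x : 'rV[R]_N | (#|[pred i | x ord0 i != 0%R]| <= s)%N].

(* The library norm on matrices is the maximum norm. *)
Definition norm2 (R : realType) (n : nat) (x : 'rV[R]_n) : R :=
  Num.sqrt (\sum_i x ord0 i ^+ 2).

Definition pointwise_holder (R : realType) (k N : nat) (alpha : R)
    (A : set 'rV[R]_k) (psi : 'rV[R]_k -> 'rV[R]_N) :=
  forall x, A x -> exists2 c : R, 0 < c &
    forall y, A y -> norm2 (psi x - psi y) <= c * norm2 (x - y) `^ alpha.

Definition holder (R : realType) (k N : nat) (alpha : R)
    (A : set 'rV[R]_k) (psi : 'rV[R]_k -> 'rV[R]_N) :=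
  exists2 c : R, 0 < c & forall x, A x ->
    forall y, A y -> norm2 (psi x - psi y) <= c * norm2 (x - y) `^ alpha.

(* Main.v *)
Require Import Defs.
From mathcomp Require Import all_boot all_order all_algebra.
From mathcomp Require Import all_classical all_reals all_analysis.
From mathcomp Require Import measurable_realfun lra.
Import Order.TTheory GRing.Theory Num.Theory.
Import numFieldNormedType.Exports.
Local Open Scope classical_set_scope.
Local Open Scope ring_scope.

(* The s-sparse vectors form a finite union of s-dimensional subspaces V_i.
   Fix a sparse x.  For y in V_i the difference x - y lies in V_i + <x>, whose
   dimension is at most s + 1 <= k, and for almost every L the restriction of L
   to this space is injective: a suitable minor is a nonzero polynomial in the
   entries of L.  Hence |x - y| <= C_x |L (x - y)| for all sparse y at once, so
   the inverse is even pointwise Lipschitz; on the bounded support of mu this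
   implies the pointwise Hoelder bounds.  Fubini turns "for every x, almost
   every L" into "for almost every L, mu-almost every x".  Discarding the x with
   C_x > n leaves a set on which the inverse is n-Lipschitz and bounded, and
   McShane's extension of its coordinates, clipped to remain bounded, is
   alpha-Hoelder for every alpha. *)

Set Implicit Arguments.
Unset Strict Implicit.

(** * Null sets of polynomials *)

Section null.
Context {R : realType}.
Local Notation RB := (measurableTypeR R).

Lemma measurable_zeros d (T : measurableType d) (f : T -> R) :
  measurable_fun setT f -> measurable [set x | f x = 0].
Proof.
move=> mf; rewrite -[X in measurable X]setTI.
by apply: (mf measurableT [set 0]); exact: measurable_set1.
Qed.

(* Polynomial in each coordinate separately: enough for the Fubini induction of
   [sep_poly_null], and stable under ring operations without multivariate
   polynomials. *)
Fixpoint sep_poly n : (n.-tuple RB -> R) -> Prop :=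
  if n is n'.+1 then fun f =>
    (forall t : n'.-tuple RB, exists p : {poly R},
        forall z : R, f [tuple of z :: t] = p.[z]) /\
    (forall z : R, sep_poly (fun t : n'.-tuple RB => f [tuple of z :: t]))
  else fun=> True.

Lemma sep_poly_cst n c : sep_poly (fun _ : n.-tuple RB => c).
Proof.
elim: n => //= n IH; split=> // t; exists c%:P => z; by rewrite hornerC.
Qed.

Lemma sep_polyD n (f g : n.-tuple RB -> R) :
  sep_poly f -> sep_poly g -> sep_poly (fun t => f t + g t).
Proof.
elim: n f g => //= n IH f g [fp fs] [gp gs]; split=> [t|z]; last exact: IH.
have [p pE] := fp t; have [q qE] := gp t.
by exists (p + q) => z; rewrite hornerD pE qE.
Qed.

Lemma sep_polyM n (f g : n.-tuple RB -> R) :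
  sep_poly f -> sep_poly g -> sep_poly (fun t => f t * g t).
Proof.
elim: n f g => //= n IH f g [fp fs] [gp gs]; split=> [t|z]; last exact: IH.
have [p pE] := fp t; have [q qE] := gp t.
by exists (p * q) => z; rewrite hornerM pE qE.
Qed.

Lemma sep_poly_tnth n i : sep_poly (fun t : n.-tuple RB => tnth t i).
Proof.
elim: n i => //= n IH i; split=> [t|z].
  case: (unliftP ord0 i) => [j ->|->].
    by exists (tnth t j)%:P => z; rewrite tnthS hornerC.
  by exists 'X => z; rewrite hornerX.
case: (unliftP ord0 i) => [j ->|->].
  rewrite (_ : (fun _ => _) = fun t => tnth t j) //.
  by apply/funext => t; rewrite tnthS.
exact: sep_poly_cst.
Qed.

Lemma sep_poly_sum n (I : Type) (r : seq I) (F : I -> n.-tuple RB -> R) :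
  (forall i, sep_poly (F i)) -> sep_poly (fun t => \sum_(i <- r) F i t).
Proof.
move=> Fp; elim: r => [|i r IH].
  under eq_fun do rewrite big_nil; exact: sep_poly_cst.
by under eq_fun do rewrite big_cons; exact: sep_polyD.
Qed.

Lemma sep_poly_prod n (I : Type) (r : seq I) (F : I -> n.-tuple RB -> R) :
  (forall i, sep_poly (F i)) -> sep_poly (fun t => \prod_(i <- r) F i t).
Proof.
move=> Fp; elim: r => [|i r IH].
  under eq_fun do rewrite big_nil; exact: sep_poly_cst.
by under eq_fun do rewrite big_cons; exact: sep_polyM.
Qed.

Lemma sep_poly_det n m (A : n.-tuple RB -> 'M[R]_m) :
  (forall i j, sep_poly (fun t => A t i j)) -> sep_poly (fun t => \det (A t)).
Proof.
move=> Ap; apply: sep_poly_sum => s; apply: sep_polyM.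
  exact: sep_poly_cst.
exact: sep_poly_prod.
Qed.

(** An infinite root set would contain [size p] distinct roots, one more than the degree allows; a
    finite set is Lebesgue null. *)
Lemma lebesgue_measure_roots (p : {poly R}) :
  p != 0 -> lebesgue_measure [set z | p.[z] = 0] = 0%E.
Proof.
move=> p0; apply: countable_lebesgue_measure0; apply: finite_set_countable.
apply: contrapT => inf.
have [A Ap sA] := infinite_set_fset (size p) inf.
have := max_poly_roots p0 _ (finmap.fset_uniq A).
rewrite ltnNge sA => /(_ _)/negP []//.
apply/allP => z /Ap /= pz; exact/rootP.
Qed.

(** Induction on the number of coordinates. With the tail of [t0] fixed, [f] is a nonzero polynomial
    [p] in the first coordinate. For [z] outside its finitely many roots, the slice of [f] at [z]
    does not vanish at the tail of [t0], so its zero set is null by induction; Tonelli concludes. *)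
Lemma sep_poly_null n (f : n.-tuple RB -> R) t0 :
  measurable_fun setT f -> sep_poly f -> f t0 != 0 ->
  lebesgue_tuple n [set t | f t = 0] = 0%E.
Proof.
elim: n f t0 => [|n IH] f t0 mf fp f0.
  rewrite /= diracE memNset//= => /eqP; apply/negP.
  by move: f0; rewrite (tuple0 t0).
pose Z := [set t | f t = 0].
pose A := @tuple_cons R n @^-1` Z.
have mA : measurable A.
  rewrite -[A]setTI; apply: measurable_tuple_cons => //.
  exact: measurable_zeros.
pose m := lebesgue_tuple n : {sigma_finite_measure set _ -> \bar R}.
(* By construction, [lebesgue_tuple n.+1] is the product measure, that is, the integral of the
   measures of the slices. *)
change ((\int[lebesgue_measure]_x (m \o xsection A) x)%E = 0%E).
under eq_integral => x _ do rewrite -[(_ \o _) _]gee0_abs ?measure_ge0//.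
have mg := measurable_fun_xsection m mA.
apply/(ae_eq_integral_abs _ measurableT mg).
case: fp => fp fs.
have [p pE] := fp [tuple of behead t0].
have p0 : p != 0.
  apply: contraNneq f0 => p0; have := pE (thead t0).
  by rewrite p0 horner0 -tuple_eta => ->.
exists [set z | p.[z] = 0]; split.
- apply: (@measurable_zeros _ RB (horner p)).
  by apply: continuous_measurable_fun; exact: continuous_horner.
- exact: lebesgue_measure_roots.
- move=> z /= H; apply: contrapT => /eqP pz; apply: H => _.
  rewrite (_ : xsection A z =
      [set t : n.-tuple RB | f [tuple of z :: t] = 0]); last first.
    by apply/seteqP; split=> t; rewrite /xsection /= inE.
  apply: (IH _ [tuple of behead t0]) => //; last by rewrite pE.
  apply: (measurableT_comp mf) => /=.
    exact: (@measurable_cons _ _ _ _ (cst z) n id).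
  exact: fs.
Qed.

Lemma sep_poly_mulmx n a b c (A : n.-tuple RB -> 'M[R]_(a, b))
    (B : n.-tuple RB -> 'M[R]_(b, c)) :
  (forall i j, sep_poly (fun t => A t i j)) ->
  (forall i j, sep_poly (fun t => B t i j)) ->
  forall i j, sep_poly (fun t => (A t *m B t) i j).
Proof.
move=> Ap Bp i j; under eq_fun do rewrite mxE.
by apply: sep_poly_sum => l; exact: sep_polyM.
Qed.

Lemma measurable_mulmx d (T : measurableType d) a b c (A : T -> 'M[R]_(a, b))
    (B : T -> 'M[R]_(b, c)) :
  (forall i j, measurable_fun setT (fun t => A t i j)) ->
  (forall i j, measurable_fun setT (fun t => B t i j)) ->
  forall i j, measurable_fun setT (fun t => (A t *m B t) i j).
Proof.
move=> mA mB i j; under eq_fun do rewrite mxE.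
by apply: measurable_sum => l; exact: measurable_funM.
Qed.

Lemma measurable_det d (T : measurableType d) m (A : T -> 'M[R]_m) :
  (forall i j, measurable_fun setT (fun t => A t i j)) ->
  measurable_fun setT (fun t => \det (A t)).
Proof.
move=> mA; apply: measurable_sum => s; apply: measurable_funM => //.
by apply: measurable_prod.
Qed.

(** * Leading minors as polynomials in the coordinates of the linear map *)

Lemma lin_of_coordsE N k (v : (N * k).-tuple RB) i j :
  lin_of_coords v i j = tnth v (mxvec_index i j).
Proof. by rewrite /lin_of_coords mxE mxE. Qed.

Lemma measurable_lin_of_coords N k i j :
  measurable_fun setT (fun v : (N * k).-tuple RB => lin_of_coords v i j).
Proof.
under eq_fun do rewrite lin_of_coordsE; exact: measurable_tnth.
Qed.

(** For [m <= k], [pid_mx m] selects the first [m] columns, so this is the leading minor of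
    [B *m L]. A single fixed minor suffices: its zero set is null and contains every [L] that is not
    injective on the row space of a row-free [B]. *)
Definition head_minor m N k (B : 'M[R]_(m, N)) (L : 'M[R]_(N, k)) : R :=
  \det (B *m L *m (pid_mx m : 'M[R]_(k, m))).

Lemma head_minor_neq0 m N k (B : 'M[R]_(m, N)) (L : 'M[R]_(N, k)) :
  head_minor B L != 0 -> row_free (B *m L).
Proof.
rewrite -unitfE -unitmxE -row_free_unit => /eqP rk.
rewrite /row_free eqn_leq rank_leq_row /= -{1}rk.
exact: mxrankM_maxl.
Qed.

Lemma head_minor_null m N k (B : 'M[R]_(m, N)) : row_free B -> (m <= k)%N ->
  lebesgue_tuple (N * k) [set v | head_minor B (lin_of_coords v) = 0] = 0%E.
Proof.
move=> /row_freeP[D BD] mk.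
(* Since [B *m D] is the identity, the minor equals 1 at [L0]; this is the point where the
   polynomial is nonzero. *)
pose L0 : 'M[R]_(N, k) := D *m pid_mx m.
pose v0 : (N * k).-tuple RB := [tuple mxvec L0 ord0 i | i < N * k].
have L0E : lin_of_coords v0 = L0.
  by apply/matrixP => i j; rewrite lin_of_coordsE tnth_mktuple mxvecE.
apply: (@sep_poly_null _ _ v0).
- apply: measurable_det; apply: measurable_mulmx => //.
  by apply: measurable_mulmx => // *; exact: measurable_lin_of_coords.
- apply: sep_poly_det; apply: sep_poly_mulmx => [|i j]; last exact: sep_poly_cst.
  apply: sep_poly_mulmx => [i j|i j]; first exact: sep_poly_cst.
  by under eq_fun do rewrite lin_of_coordsE; exact: sep_poly_tnth.
- by rewrite /head_minor L0E mulmxA BD mul1mx mul_pid_mx minnn (minn_idPr mk)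
    pid_mx_1 det1 oner_neq0.
Qed.
End null.

(** * Injectivity on subspaces *)

Section mx.
Context {R : realType}.

Lemma mx_entry_le m n (x : 'M[R]_(m, n)) i j : `|x i j| <= `|x|.
Proof.
rewrite [leRHS]/Num.norm /= mx_normrE.
exact: (le_bigmax _ (fun ij : 'I_m * 'I_n => `|x ij.1 ij.2|) (i, j)).
Qed.

Lemma mx_norm_le m n (x : 'M[R]_(m, n)) c :
  0 <= c -> (forall i j, `|x i j| <= c) -> `|x| <= c.
Proof.
move=> c0 xc; rewrite [leLHS]/Num.norm /= mx_normrE.
by apply/bigmax_leP; split=> // -[i j] _; exact: xc.
Qed.

Lemma mulmx_norm_le N k (E : 'M[R]_(N, k)) :
  exists2 C : R, 0 < C & forall x : 'rV[R]_N, `|x *m E| <= C * `|x|.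
Proof.
exists (N%:R * `|E| + 1) => [|x].
  by rewrite ltr_pwDr// mulr_ge0.
rewrite mulrDl mul1r; apply: ler_wpDr => //.
apply: mx_norm_le => [|i j]; first by rewrite !mulr_ge0.
rewrite mxE (le_trans (ler_norm_sum _ _ _))//.
apply: (@le_trans _ _ (\sum_(l < N) `|E| * `|x|)).
  apply: ler_sum => l _; rewrite normrM mulrC.
  by apply: ler_pM => //; exact: mx_entry_le.
by rewrite sumr_const card_ord -mulrA mulr_natl.
Qed.

Lemma continuous_mulmxr N k (E : 'M[R]_(N, k)) :
  continuous (fun x : 'rV[R]_N => x *m E).
Proof.
have [C C0 HC] := mulmx_norm_le E.
apply: (@bounded_linear_continuous _ _ _ (mulmxr E)).
apply/linear_boundedP; exists C; split=> [|r Cr x]; first exact: gtr0_real.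
by apply: (le_trans (HC x)); apply: ler_wpM2r => //; exact: ltW.
Qed.

(** With [D] a right inverse of [B *m L], a vector [x = a *m B] is recovered from [x *m L] through
    multiplication by [D *m B], which is bounded. *)
Lemma row_free_mulmx_bound m N k (B : 'M[R]_(m, N)) (L : 'M[R]_(N, k)) :
  row_free (B *m L) ->
  exists2 C : R, 0 < C &
    forall x : 'rV[R]_N, (x <= B)%MS -> `|x| <= C * `|x *m L|.
Proof.
move=> /row_freeP[D BLD]; have [C C0 HC] := mulmx_norm_le (D *m B).
exists C => // x /submxP[a ->]; apply: le_trans (HC _).
by rewrite -(mulmxA a) (mulmxA (_ *m _)) -(mulmxA a) BLD mulmx1.
Qed.

(** The row space of [B] meets the line of [x] in rank at most 1, and rank 1 would put [x] in that
    row space; so the sum is direct and the ranks add up. *)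
Lemma row_free_col_mx s N (B : 'M[R]_(s, N)) (x : 'rV[R]_N) :
  row_free B -> ~~ (x <= B)%MS -> row_free (col_mx B x).
Proof.
move=> Bf xB.
have x0 : x != 0 by apply: contraNneq xB => ->; rewrite sub0mx.
rewrite /row_free -addsmxE mxrank_disjoint_sum.
  by rewrite (eqP Bf) rank_rV x0.
apply/eqP; rewrite -mxrank_eq0 -leqn0 -ltnS.
have : (\rank (B :&: x) <= \rank x)%N by rewrite mxrankS// capmxSr.
rewrite rank_rV x0 /= leq_eqVlt => /orP[/eqP r1|//].
case/negP: xB; apply: (submx_trans _ (capmxSl B x)).
by rewrite -(geq_leqif (mxrank_leqif_sup (capmxSr B x))) r1 rank_rV x0.
Qed.
End mx.

(** * Generic injectivity *)

Section rV.
Context {R : realType}.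
Local Notation RB := (measurableTypeR R).

(** Tonelli for the indicator of [A]: one iterated integral is zero, hence so is the other, and a
    nonnegative function with zero integral vanishes almost everywhere. *)
Lemma ae_ysection_null d1 d2 (T1 : measurableType d1) (T2 : measurableType d2)
    (m1 : {sigma_finite_measure set T1 -> \bar R})
    (m2 : {sigma_finite_measure set T2 -> \bar R}) (A : set (T1 * T2)) :
  measurable A -> (forall x, m2 (xsection A x) = 0%E) ->
  {ae m2, forall y, m1 (ysection A y) = 0%E}.
Proof.
move=> mA A0; have := indic_fubini_tonelli m1 m2 mA.
rewrite indic_fubini_tonelli_FE// indic_fubini_tonelli_GE//.
rewrite integral0_eq => [|x _]; last exact: A0.
under eq_integral => x _ do rewrite -[(_ \o _) _]gee0_abs ?measure_ge0//.
move/esym/(ae_eq_integral_abs _ measurableT (measurable_fun_ysection m1 mA)).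
by apply: filterS => y /(_ I).
Qed.

Lemma measurable_closed N (A : set 'rV[R]_N) :
  closed A -> measurable (A : set (borel_rV R N)).
Proof.
move=> cA; rewrite -[A]setCK; apply: measurableC.
by apply: sub_sigma_algebra; exact: closed_openC.
Qed.

Lemma measurable_continuous_rV N (f : 'rV[R]_N -> R) :
  continuous f -> measurable_fun setT (f : borel_rV R N -> R).
Proof.
move=> cf; apply: (measurability _ (RGenOpens.measurableE R)).
move=> _ [_ [a [b ->] <-]]; rewrite setTI; apply: sub_sigma_algebra.
by move/continuousP: cf; apply; exact: interval_open.
Qed.

Lemma measurable_coord_rV N (i : 'I_1) j :
  measurable_fun setT (fun x : borel_rV R N => (x : 'rV[R]_N) i j).
Proof. exact: measurable_continuous_rV (@coord_continuous _ _ _ _ _). Qed.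

Lemma measurable_rV_submx s N (B : 'M[R]_(s, N)) :
  measurable ([set x : 'rV[R]_N | (x <= B)%MS] : set (borel_rV R N)).
Proof.
rewrite (_ : [set _ | _] =
    \bigcap_(j in [set: 'I_N]) [set x | (x *m cokermx B) ord0 j = 0]).
  apply: fin_bigcap_measurable => // j _; apply: measurable_zeros.
  by apply: measurable_mulmx => // *; exact: measurable_coord_rV.
apply/seteqP; split=> x /=; rewrite submxE.
  by move=> /eqP/rowP e j _; have := e j; rewrite [RHS]mxE.
by move=> H; apply/eqP/rowP => j; rewrite H// mxE.
Qed.

Lemma measurable_col_mx_rV s N (B : 'M[R]_(s, N)) i j :
  measurable_fun setT (fun x : borel_rV R N => col_mx B (x : 'rV[R]_N) i j).
Proof.
under eq_fun do rewrite mxE.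
case: (fintype.split i) => i'; first exact: measurable_cst.
exact: measurable_coord_rV.
Qed.

(* For x outside the row space of B, the vanishing of this minor is necessary for
   L to fail to be injective on the space spanned by B and x. *)
Definition unseparated s N k (B : 'M[R]_(s, N)) (L : 'M[R]_(N, k)) :
    set 'rV[R]_N :=
  [set x | ~ (x <= B)%MS /\ head_minor (col_mx B x) L = 0].

Lemma ae_unseparated_null s N k (B : 'M[R]_(s, N))
    (mu : {sigma_finite_measure set (borel_rV R N) -> \bar R}) :
  row_free B -> (s < k)%N ->
  ae_linear (fun L : 'M[R]_(N, k) =>
    measurable (unseparated B L : set (borel_rV R N)) /\
    mu (unseparated B L) = 0%E).
Proof.
move=> Bf sk.
pose A : set (borel_rV R N * (N * k).-tuple RB) :=
  [set z | ~ ((z.1 : 'rV[R]_N) <= B)%MS /\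
    head_minor (col_mx B (z.1 : 'rV[R]_N)) (lin_of_coords z.2) = 0].
have mA : measurable A.
  rewrite (_ : A = (fst @^-1` ~` [set x : 'rV[R]_N | (x <= B)%MS]) `&`
    [set z | head_minor (col_mx B (z.1 : 'rV[R]_N)) (lin_of_coords z.2) = 0])//.
  apply: measurableI.
    rewrite -[X in measurable X]setTI; apply: measurable_fst => //.
    by apply: measurableC; exact: measurable_rV_submx.
  apply: measurable_zeros; apply: measurable_det; apply: measurable_mulmx => //.
  apply: measurable_mulmx => i j.
    exact: (measurableT_comp (measurable_col_mx_rV B i j) measurable_fst).
  exact: (measurableT_comp (measurable_lin_of_coords i j) measurable_snd).
have AE v : ysection A v = unseparated B (lin_of_coords v).
  by apply/seteqP; split=> x; rewrite /ysection /= inE.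
(* The section is empty for [x] in the row space of [B]. Otherwise [col_mx B x] is row-free with
   [s + 1] rows, and [s < k] makes its minor available. *)
have A0 x : lebesgue_tuple (N * k) (xsection A x) = 0%E.
  have [xB|xB] := boolP ((x : 'rV[R]_N) <= B)%MS.
    rewrite (_ : xsection A x = set0) ?measure0//.
    by apply/seteqP; split=> // v; rewrite /xsection /= inE => -[].
  rewrite (_ : xsection A x =
      [set v | head_minor (col_mx B (x : 'rV[R]_N)) (lin_of_coords v) = 0]).
    by apply: head_minor_null; rewrite ?addn1//; exact: row_free_col_mx.
  apply/seteqP; split=> v; rewrite /xsection /= inE; first by case.
  by split=> //; exact/negP.
move: (ae_ysection_null mu mA A0); apply: filterS => v; rewrite AE => v0.
by split=> //; rewrite -AE; exact: measurable_ysection.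
Qed.

Lemma ae_head_minor_neq0 s N k (B : 'M[R]_(s, N)) : row_free B -> (s <= k)%N ->
  ae_linear (fun L : 'M[R]_(N, k) => head_minor B L <> 0).
Proof.
move=> Bf sk; exists [set v | head_minor B (lin_of_coords v) = 0].
split; last by move=> v /= /contrapT.
- apply: measurable_zeros; apply: measurable_det; apply: measurable_mulmx => //.
  by apply: measurable_mulmx => // *; exact: measurable_lin_of_coords.
- exact: head_minor_null.
Qed.
End rV.

(** * Lipschitz and Hoelder maps *)

Section lip.
Context {R : realType}.

(** Interpolation: in [t = t ^ alpha * t ^ (1 - alpha)], the first factor is bounded through
    [t <= C * d] and the second through [t <= M]. *)
Lemma bounded_lipschitz_powR (alpha C M t d : R) :
  0 < alpha < 1 -> 0 <= C -> 0 <= d -> 0 <= t -> t <= C * d -> t <= M ->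
  t <= C `^ alpha * M `^ (1 - alpha) * d `^ alpha.
Proof.
move=> /andP[a0 a1] C0 d0 t0 tCd tM.
have M0 := le_trans t0 tM.
have CE : alpha + (1 - alpha) = 1 by rewrite addrC subrK.
rewrite -{1}[t]powRr1// -[X in t `^ X]CE powRD; last by rewrite CE oner_eq0.
rewrite mulrAC -powRM//; apply: ler_pM; rewrite ?powR_ge0//.
- by apply: ge0_ler_powR; rewrite ?nnegrE ?mulr_ge0// ltW.
- by apply: ge0_ler_powR; rewrite ?nnegrE// subr_ge0 ltW.
Qed.

Lemma mx_norm_le_norm2 n (x : 'rV[R]_n) : `|x| <= norm2 x.
Proof.
apply: mx_norm_le => [|i j]; first exact: sqrtr_ge0.
rewrite (ord1 i) -sqrtr_sqr ler_wsqrtr// (bigD1 j)//= lerDl.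
by apply: sumr_ge0 => l _; exact: sqr_ge0.
Qed.

Lemma norm2_le_mx_norm n (x : 'rV[R]_n) : norm2 x <= Num.sqrt n%:R * `|x|.
Proof.
rewrite -[`|x|]ger0_norm// -sqrtr_sqr -sqrtrM// ler_wsqrtr//.
rewrite mulr_natl; apply: (@le_trans _ _ (\sum_(j < n) `|x| ^+ 2)); last first.
  by rewrite sumr_const card_ord.
apply: ler_sum => j _.
by rewrite -real_normK ?num_real// lerXn2r ?nnegrE//; exact: mx_entry_le.
Qed.

Lemma lipschitz_continuous (V W : normedModType R) (g : V -> W) (C : R) :
  (forall x y, `|g x - g y| <= C * `|x - y|) -> continuous g.
Proof.
move=> gC x; apply/cvgrPdist_le => e e0.
have C1 : 0 < `|C| + 1 by rewrite ltr_wpDl.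
near=> y; apply: (le_trans (gC x y)).
apply: (@le_trans _ _ ((`|C| + 1) * `|x - y|)).
  by rewrite ler_wpM2r// (le_trans (ler_norm C))// lerDl.
rewrite mulrC -ler_pdivlMr//.
by near: y; apply: cvgr_dist_le => //; rewrite divr_gt0.
Unshelve. all: by end_near. Qed.

(* McShane's formula: g z is the infimum over a in A of h a + C |z - a|. *)
Lemma lipschitz_extension (V : normedModType R) (A : set V) (h : V -> R)
    (C : R) :
  0 <= C -> (forall x y, A x -> A y -> `|h x - h y| <= C * `|x - y|) ->
  exists2 g : V -> R, (forall x y, `|g x - g y| <= C * `|x - y|) &
    forall x, A x -> g x = h x.
Proof.
move=> C0 hC.
have [[a0 Aa0]|/forallNP A0] := pselect (exists a, A a); last first.
  by exists (cst 0) => [x y|x /A0//]; rewrite subrr normr0 mulr_ge0.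
pose E z := [set h a + C * `|z - a| | a in A].
have E0 z : E z !=set0 by exists (h a0 + C * `|z - a0|), a0.
(* The infimum is meaningful only for a nonempty set bounded below; comparison with the fixed point
   [a0] gives the bound. *)
have lbE z : has_lbound (E z).
  exists (h a0 - C * `|z - a0|) => _ [a Aa <-].
  rewrite lerBlDr -addrA -lerBlDl -mulrDr.
  apply: le_trans (ler_norm _) _; apply: le_trans (hC _ _ Aa0 Aa) _.
  rewrite ler_wpM2l// [leRHS]addrC (distrC z a0); exact: ler_distD.
exists (fun z => inf (E z)) => [|x Ax]; last first.
  apply/eqP; rewrite eq_le; apply/andP; split.
    by apply: ge_inf => //; exists x; rewrite // subrr normr0 mulr0 addr0.
  apply: lb_le_inf => // _ [a Aa <-].
  rewrite -lerBlDl; apply: le_trans (ler_norm _) _; exact: hC.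
have half x y : inf (E x) - inf (E y) <= C * `|x - y|.
  rewrite lerBlDr -lerBlDl; apply: lb_le_inf => // _ [a Aa <-].
  rewrite lerBlDl; apply: (@le_trans _ _ (h a + C * `|x - a|)).
    by apply: ge_inf => //; exists a.
  rewrite addrCA lerD2l -mulrDr ler_wpM2l//; exact: ler_distD.
by move=> x y; rewrite ler_norml lerNl opprB half distrC half.
Qed.

Lemma bounded_lipschitz_extension (V : normedModType R) (A : set V) (h : V -> R)
    (C M : R) :
  0 <= C -> 0 <= M -> (forall x, A x -> `|h x| <= M) ->
  (forall x y, A x -> A y -> `|h x - h y| <= C * `|x - y|) ->
  exists g : V -> R, [/\ forall x y, `|g x - g y| <= C * `|x - y|,
    forall x, `|g x| <= M & forall x, A x -> g x = h x].
Proof.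
move=> C0 M0 hM hC; have [g gC gh] := lipschitz_extension C0 hC.
(* Truncation to the interval from [- M] to [M] is 1-Lipschitz and fixes the values of [h]. *)
pose clip w := Num.max (- M) (Num.min M w).
have clipP w : [\/ w <= - M /\ clip w = - M, M <= w /\ clip w = M |
                    - M <= w <= M /\ clip w = w].
  rewrite /clip; have [Mw|wM] := leP M w.
    by rewrite max_r; [exact: Or32|lra].
  have [Mw|wM'] := leP (- M) w; first by apply: Or33; split=> //; lra.
  by apply: Or31; rewrite ltW.
exists (clip \o g); split=> [x y|x|x Ax] /=.
- apply: le_trans (gC x y); move: (g x) (g y) => u v.
  have uv := ler_norm (u - v); have vu := ler_norm (v - u).
  rewrite distrC in vu; rewrite ler_norml; apply/andP.
  by case: (clipP u) => -[? ->]; case: (clipP v) => -[? ->]; split; lra.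
- by rewrite ler_norml; apply/andP; case: (clipP (g x)) => -[? ->]; split; lra.
- have := hM x Ax; rewrite ler_norml -gh// => ?.
  by case: (clipP (g x)) => -[? ->]; lra.
Qed.

End lip.

(** * Almost sure Lipschitz inverses *)

Section ae_lipschitz.
Context {R : realType}.

(** Second countability: a point outside the support has a null open neighbourhood, hence lies in a
    null ball with rational centre and radius, and there are countably many of these. *)
Lemma measure_support_null N
    (mu : {finite_measure set (borel_rV R N) -> \bar R}) :
  closed (measure_support mu) -> mu (~` measure_support mu) = 0%E.
Proof.
move=> cS; apply: measure_negligible.
  by apply: measurableC; exact: measurable_closed.
pose b (z : 'rV[rat]_N * rat) := ball (map_mx ratr z.1 : 'rV[R]_N) (ratr z.2).
pose F n : set (borel_rV R N) :=
  if @unpickle ('rV[rat]_N * rat)%type n is Some z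
  then if mu (b z) == 0%E then b z else set0 else set0.
have mb z : measurable (b z : set (borel_rV R N)).
  by apply: sub_sigma_algebra; exact: ball_open.
apply: (@negligibleS _ _ _ _ (\bigcup_n F n)); last first.
  apply: negligible_bigcup => n; rewrite /F; case: unpickle => [z|].
    case: ifPn => [/eqP z0|_]; last exact: negligible_set0.
    by apply/negligibleP; [exact: mb|exact: z0].
  exact: negligible_set0.
move=> x /existsNP[U /not_implyP[[oU Ux] /negP U0]].
have mU : measurable (U : set (borel_rV R N)) by exact: sub_sigma_algebra.
have {}U0 : mu U = 0%E.
  by apply/eqP; rewrite eq_le measure_ge0 andbT leNgt.
have /nbhs_ballP[e /= e0 eU] : nbhs x U by exact: open_nbhs_nbhs.
have e20 : 0 < e / 2 by rewrite divr_gt0.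
(* The rational centre is taken within [r] of [x], so its [r]-ball contains [x] and stays within
   [2 * r < e] of it. *)
have [r _ /andP[r0 re]] : exists2 r : rat, True & 0 < (ratr r : R) < e / 2.
  by have [r /itvP h] := rat_in_itvoo e20; exists r => //; rewrite !h.
have /choice[q qP] : forall j, exists q : rat,
    `|ratr q - x ord0 j| < ratr r :> R.
  move=> j.
  have [|q] := @rat_in_itvoo R (x ord0 j - ratr r) (x ord0 j + ratr r).
    by rewrite ltrD2l gt0_cp.
  by move=> /itvP h; exists q; rewrite ltr_distl !h.
pose z : 'rV[rat]_N * rat := (\row_j q j, r).
have zx : b z x.
  by rewrite /b; split=> // i j; rewrite (ord1 i) !mxE; exact: qP.
have zU : b z `<=` U.
  move=> y zy; apply: eU; apply: (@le_ball _ _ _ (ratr r + ratr r)).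
    by rewrite [leRHS]splitr lerD// ltW.
  by apply: ball_triangle zy; exact: ball_sym.
exists (pickle z) => //; rewrite /F pickleK ifT//.
by rewrite eq_le measure_ge0 andbT -U0 le_measure ?inE.
Qed.

Section union.
Variables (N s k : nat) (I : finType) (B : I -> 'M[R]_(s, N)).
Hypotheses (Bf : forall i, row_free (B i)) (s_lt_k : (s < k)%N).
Variable mu : {finite_measure set (borel_rV R N) -> \bar R}.
Hypothesis muB : mu (~` [set x : 'rV[R]_N | exists i, (x <= B i)%MS]) = 0%E.
Hypothesis mu_cpt : compact (measure_support mu).

(** Only [y] ranges over [X], while [x] is free: the set is an intersection of closed conditions on
    [x], hence Borel for any [X]. *)
Definition lipschitz_at (L : 'M[R]_(N, k)) (X : set 'rV[R]_N) (C : R) :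
    set 'rV[R]_N :=
  [set x | forall y, X y -> `|x - y| <= C * `|(x - y) *m L|].

(** For [y] in the row space of [B i], the difference [x - y] lies in that space or in the one
    spanned by it and [x]. Either way a nonzero minor bounds [x - y], and finitely many [i] leave
    one constant. *)
Lemma separated_lipschitz_at (L : 'M[R]_(N, k)) (x : 'rV[R]_N) :
  (forall i, head_minor (B i) L <> 0) ->
  (forall i, ~ unseparated (B i) L x) ->
  exists2 C, 0 < C & lipschitz_at L [set y | exists i, (y <= B i)%MS] C x.
Proof.
move=> BL xL.
have /choice[C HC] i : exists C, 0 < C /\
    forall y, (y <= B i)%MS -> `|x - y| <= C * `|(x - y) *m L|.
  have [xB|xB] := boolP (x <= B i)%MS.
    have /eqP/head_minor_neq0/row_free_mulmx_bound[C C0 HC] := BL i.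
    by exists C; split=> // y yB; apply: HC; rewrite addmx_sub// eqmx_opp.
  have /eqP/head_minor_neq0/row_free_mulmx_bound[C C0 HC] :
      head_minor (col_mx (B i) x) L <> 0.
    by move=> H; apply: (xL i); split=> //; exact/negP.
  exists C; split=> // y yB; apply: HC; rewrite -addsmxE addrC.
  by apply: addmx_sub_adds => //; rewrite eqmx_opp.
(* The sum dominates each [C i]; the 1 keeps the constant positive even for empty [I]. *)
exists (1 + \sum_i C i) => [|y [i yB]].
  by rewrite ltr_wpDr// sumr_ge0// => i _; apply/ltW; case: (HC i).
have [_ /(_ _ yB) H] := HC i; apply: (le_trans H); rewrite ler_wpM2r//.
rewrite (bigD1 i)//= addrCA lerDl addr_ge0// sumr_ge0// => j _.
by apply/ltW; case: (HC j).
Qed.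

Lemma ae_lipschitz_inverse : ae_linear (fun L : 'M[R]_(N, k) =>
  exists X : set (borel_rV R N),
    [/\ measurable X, mu (~` X) = 0%E,
        exists2 M, 0 < M & forall x : 'rV[R]_N, X x -> `|x| <= M &
        forall x, X x -> exists2 C, 0 < C & lipschitz_at L X C x]).
Proof.
have hL : ae_linear (fun L : 'M[R]_(N, k) => forall i, head_minor (B i) L <> 0).
  by apply: filter_forall => i; exact: ae_head_minor_neq0 (Bf i) (ltnW s_lt_k).
have uL : ae_linear (fun L : 'M[R]_(N, k) => forall i,
    measurable (unseparated (B i) L : set (borel_rV R N)) /\
    mu (unseparated (B i) L) = 0%E).
  by apply: filter_forall => i; exact: ae_unseparated_null mu (Bf i) s_lt_k.
rewrite /ae_linear in hL uL *; apply: filterS2 hL uL => v /=.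
set L := lin_of_coords v => hL uL.
pose S := [set x : 'rV[R]_N | exists i, (x <= B i)%MS] : set (borel_rV R N).
pose K := measure_support mu : set (borel_rV R N).
pose Z := \bigcup_(i in [set: I]) (unseparated (B i) L : set (borel_rV R N)).
have mS : measurable S.
  rewrite (_ : S = \bigcup_(i in [set: I]) [set x : 'rV[R]_N | (x <= B i)%MS]).
    by apply: fin_bigcup_measurable => // i _; exact: measurable_rV_submx.
  by apply/seteqP; split=> x [i]; exists i.
have cK : closed (measure_support mu).
  by apply: compact_closed => //; exact: norm_hausdorff.
have mK : measurable K by exact: measurable_closed.
have mZ : measurable Z by apply: fin_bigcup_measurable => // i _; case: (uL i).
have mX : measurable ((K `&` S) `&` ~` Z).
  by apply: measurableI; [exact: measurableI|exact: measurableC].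
(* [K] makes the set bounded, [S] places every [y] in one of the subspaces, and removing [Z] gives
   every [x] its constant. *)
exists ((K `&` S) `&` ~` Z); split=> //.
- apply: measure_negligible; first exact: measurableC.
  rewrite !setCI setCK; apply: negligibleU; first apply: negligibleU.
  + by apply/negligibleP; [exact: measurableC|exact: measure_support_null].
  + by apply/negligibleP => //; exact: measurableC.
  + have : {ae mu, forall x, forall i, ~ unseparated (B i) L x}.
      apply: filter_forall => i; have [mU U0] := uL i.
      by exists (unseparated (B i) L); split=> // x /contrapT.
    by apply: negligibleS => x [i _ ?] /(_ i).
- have [M [_ HM]] := compact_bounded mu_cpt.
  exists (`|M| + 1) => [|x [[Kx _] _]]; first by rewrite ltr_wpDl.
  by apply: HM => //; rewrite (le_lt_trans (ler_norm M))// ltrDl.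
- move=> x [[_ _] Zx]; have [|C C0 HC] := @separated_lipschitz_at L x hL.
    by move=> i ux; apply: Zx; exists i.
  by exists C => // y [[_ Sy] _]; exact: HC.
Qed.
End union.
End ae_lipschitz.

(** * Sparse vectors *)

Section sparse.
Context {R : realType}.

Lemma row_free_rowsub1 s N (f : 'I_s -> 'I_N) :
  injective f -> row_free (rowsub f (1%:M : 'M[R]_N)).
Proof.
move=> fI; apply/row_freeP; exists (colsub f 1%:M).
rewrite mul_rowsub_mx mul1mx; apply/matrixP => i j.
by rewrite !mxE (inj_eq fI).
Qed.

Lemma submx_rowsub1 s N (f : 'I_s -> 'I_N) (x : 'rV[R]_N) :
  (x <= rowsub f 1%:M)%MS <-> (forall j, x ord0 j != 0 -> exists i, f i = j).
Proof.
split=> [/submxP[a ->] j|xf].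
  rewrite mxE; apply: contra_neqP => fj; apply: big1 => i _.
  rewrite !mxE (_ : (_ == _) = false) ?mulr0//.
  by apply/negP => /eqP ij; apply: fj; exists i.
rewrite [x]row_sum_delta; apply: summx_sub => j _.
have [->|/xf[i <-]] := eqVneq (x ord0 j) 0; first by rewrite scale0r sub0mx.
apply: scalemx_sub; rewrite (_ : delta_mx _ _ = row i (rowsub f 1%:M)).
  exact: row_sub.
by apply/rowP => l; rewrite !mxE eqxx /= eq_sym.
Qed.

(** Smaller supports are padded to exactly [s] coordinates, so that all the subspaces have dimension
    [s] and are indexed by a finite type of injections. *)
Lemma sparseE N s : (s <= N)%N ->
  @sparse R N s = [set x | exists f : {f : {ffun 'I_s -> 'I_N} | injectiveb f},
    (x <= rowsub (val f) 1%:M)%MS].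
Proof.
move=> sN; apply/seteqP; split=> x /= => [xs|[f /submx_rowsub1 xf]]; last first.
  apply: (@leq_trans #|codom (val f)|); last first.
    by rewrite (leq_trans (card_size _))// size_codom card_ord.
  apply: subset_leq_card; apply/fintype.subsetP => j /xf[i <-].
  exact: codom_f.
set P := [pred i | x ord0 i != 0] in xs.
(* All coordinates are listed with the support of [x] first; the first [s] entries then cover the
   support. *)
have szt : size (enum P ++ enum (predC P)) == N.
  by rewrite size_cat -!cardE cardC card_ord.
pose t := Tuple szt.
have tI : injective (tnth t).
  apply/tuple_uniqP; rewrite /= cat_uniq !enum_uniq /= andbT.
  by apply/hasPn => j; rewrite !mem_enum.
pose f := [ffun i : 'I_s => tnth t (widen_ord sN i)].
have fI : injectiveb f.
  apply/injectiveP => i j; rewrite !ffunE => /tI /(congr1 val) /= ij.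
  exact: val_inj.
exists (Sub f fI); apply/submx_rowsub1 => j xj.
have jP : j \in enum P by rewrite mem_enum.
have js : (index j (enum P) < s)%N.
  by rewrite (leq_trans _ xs)// cardE index_mem.
exists (Ordinal js); rewrite SubK ffunE (tnth_nth j) /= nth_cat index_mem jP.
exact: nth_index.
Qed.
End sparse.

(** * Hoelder inverses *)

Lemma continuous_norm_gap (R : realType) (V W : normedModType R) (C : R) (y : V)
    (f : V -> W) : continuous f ->
  continuous (fun x : V => C * `|f (x - y)| - `|x - y| : R).
Proof.
move=> cf x; have cB : z - y @[z --> x] --> x - y.
  by apply: cvgB; [exact: cvg_id|exact: cvg_cst].
apply: cvgB; last exact: cvg_norm cB.
apply: cvgM; first exact: cvg_cst.
by apply: cvg_norm; apply: (cvg_comp _ _ cB); exact: cf.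
Qed.

Section consequences.
Context {R : realType}.
Variables (N k : nat) (L : 'M[R]_(N, k)) (X : set 'rV[R]_N).

(** Passing from the maximum norm to the Euclidean one costs [Num.sqrt N%:R] on the left and nothing
    on the right. *)
Lemma bounded_lipschitz_norm2 (alpha C M : R) (u v : 'rV[R]_k)
    (p q : 'rV[R]_N) :
  0 < alpha < 1 -> 0 <= C -> `|p - q| <= C * `|u - v| -> `|p - q| <= M ->
  norm2 (p - q) <= Num.sqrt N%:R * (C `^ alpha * M `^ (1 - alpha)) *
    norm2 (u - v) `^ alpha.
Proof.
move=> a01 C0 pqC pqM; apply: (le_trans (norm2_le_mx_norm _)).
rewrite -mulrA ler_wpM2l// bounded_lipschitz_powR// ?sqrtr_ge0//.
by rewrite (le_trans pqC)// ler_wpM2l// mx_norm_le_norm2.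
Qed.

Lemma holder_const_gt0 (alpha C M : R) : (0 < N)%N -> 0 < C -> 0 < M ->
  0 < Num.sqrt N%:R * (C `^ alpha * M `^ (1 - alpha)).
Proof. by move=> N0 C0 M0; rewrite !mulr_gt0 ?powR_gt0// sqrtr_gt0 ltr0n. Qed.

Hypothesis N_gt0 : (0 < N)%N.
Variable M : R.
Hypotheses (M_gt0 : 0 < M) (XM : forall x : 'rV[R]_N, X x -> `|x| <= M).

Let diamX (x y : 'rV[R]_N) : X x -> X y -> `|x - y| <= M + M.
Proof. by move=> Xx Xy; rewrite (le_trans (ler_normB _ _))// lerD// XM. Qed.

Let f := fun x : 'rV[R]_N => x *m L.

Hypothesis XC : forall x, X x -> exists2 C, 0 < C & lipschitz_at L X C x.

Lemma lipschitz_at_inj : set_inj X f.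
Proof.
move=> x y /set_mem Xx /set_mem Xy fxy; have [C _ /(_ _ Xy)] := XC Xx.
rewrite mulmxBl -/(f x) -/(f y) fxy subrr normr0 mulr0 normr_le0 subr_eq0.
by move/eqP.
Qed.

Let pinv_f (x : 'rV[R]_N) : X x -> pinv X f (f x) = x.
Proof.
move=> Xx.
exact: (@pinvKV _ _ (fun=> point) X f lipschitz_at_inj _ (mem_set Xx)).
Qed.

Lemma pointwise_holder_pinv alpha : 0 < alpha < 1 ->
  pointwise_holder alpha (f @` X) (pinv X f).
Proof.
move=> a01 _ [x Xx <-]; have [C C0 HC] := XC Xx.
(* [M + M] bounds the diameter of [X]. *)
exists (Num.sqrt N%:R * (C `^ alpha * (M + M) `^ (1 - alpha))).
  by rewrite holder_const_gt0// addr_gt0.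
move=> _ [y Xy <-]; rewrite !pinv_f//; apply: bounded_lipschitz_norm2 => //.
- exact: ltW.
- by rewrite -mulmxBl; exact: HC.
- exact: diamX.
Qed.

Variable mu : {finite_measure set (borel_rV R N) -> \bar R}.
Hypotheses (mX : measurable (X : set (borel_rV R N))) (muX : mu (~` X) = 0%E).

Lemma closed_lipschitz_at (C : R) : closed (lipschitz_at L X C).
Proof.
rewrite (_ : lipschitz_at L X C = \bigcap_(y in X)
    [set x : 'rV[R]_N | 0 <= C * `|(x - y) *m L| - `|x - y|]); last first.
  by apply/seteqP; split=> x /= H y /H; rewrite /= subr_ge0.
apply: closed_bigI => y _.
have cf := @continuous_norm_gap R _ _ C y _ (@continuous_mulmxr R N k L).
by apply: (preimage_closed _ (@closed_ge _ 0)) => x _; exact: cf.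
Qed.

Lemma uniform_lipschitz_at (eps : R) : 0 < eps ->
  exists2 C : R, 0 < C & (mu (~` (X `&` lipschitz_at L X C)) <= eps%:E)%E.
Proof.
move=> eps0.
pose F n : set (borel_rV R N) := ~` (X `&` lipschitz_at L X n.+1%:R).
have mF n : measurable (F n).
  apply/measurableC/measurableI => //.
  apply: measurable_closed; exact: closed_lipschitz_at.
have FX : \bigcap_n F n = ~` X.
  apply/seteqP; split=> [x Fx Xx|x Xx n _ []//].
  have [C C0 HC] := XC Xx; apply: (Fx (Num.truncn C)) => //; split=> // y Xy.
  by rewrite (le_trans (HC y Xy))// ler_wpM2r// ltW// truncnS_gt.
have nF : nonincreasing_seq F.
  apply/nonincreasing_seqP => n; apply/subsetPset; apply: subsetC => x [Xx xn].
  split=> // y Xy; rewrite (le_trans (xn y Xy))// ler_wpM2r//.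
  by rewrite ler_nat.
have mFX : measurable (\bigcap_n F n) by rewrite FX; exact: measurableC.
have F0 : mu (\bigcap_n F n) = 0%E by rewrite FX; exact: muX.
have : mu \o F @ \oo --> 0%E.
  rewrite -F0; apply: nonincreasing_cvg_mu => //.
  by rewrite -ge0_fin_numE// fin_num_measure.
have eps_gt0E : (0 < eps%:E)%E by rewrite lte_fin.
move=> /(_ _ (open_ereal_lt' eps_gt0E))[n _ Hn].
exists n.+1%:R => //; exact: (ltW (Hn n (leqnn n))).
Qed.

Lemma holder_recovery (alpha eps : R) : 0 < alpha < 1 -> 0 < eps ->
  exists2 g : 'rV[R]_k -> 'rV[R]_N, holder alpha setT g &
    (mu [set x : 'rV[R]_N | g (x *m L) <> x] <= eps%:E)%E.
Proof.
move=> a01 /uniform_lipschitz_at[C C0 muC].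
set Y := X `&` _ in muC; pose h j u := pinv X f u ord0 j.
(* Each coordinate of the inverse is extended from the image of [Y]. The bound [M] is kept because,
   at large distances, a Lipschitz estimate alone gives no Hoelder estimate with [alpha < 1]. *)
have /choice[g gP] j : exists gj : 'rV[R]_k -> R,
    [/\ forall u v, `|gj u - gj v| <= C * `|u - v|, forall u, `|gj u| <= M &
        forall u, (f @` Y) u -> gj u = h j u].
  apply: bounded_lipschitz_extension; [exact: ltW|exact: ltW| |].
    move=> _ [x [Xx _] <-]; rewrite /h pinv_f//.
    by rewrite (le_trans (mx_entry_le _ _ _))// XM.
  move=> _ _ [x [Xx xC] <-] [y [Xy _] <-]; rewrite /h !pinv_f// -mulmxBl.
  apply: le_trans (xC _ Xy).
  by have := mx_entry_le (x - y) ord0 j; rewrite !mxE.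
exists (fun u => \row_j g j u).
  exists (Num.sqrt N%:R * (C `^ alpha * (M + M) `^ (1 - alpha))).
    by rewrite holder_const_gt0// addr_gt0.
  move=> u _ v _; apply: bounded_lipschitz_norm2 => //; first exact: ltW.
    apply: mx_norm_le => [|i j]; first by rewrite mulr_ge0// ltW.
    by rewrite !mxE; case: (gP j).
  apply: mx_norm_le => [|i j]; first by rewrite addr_ge0// ltW.
  by rewrite !mxE (le_trans (ler_normB _ _))// lerD//; case: (gP j).
apply: le_trans muC; apply: le_measure; rewrite ?inE.
- rewrite (_ : [set x | _] = ~` \bigcap_(j in [set: 'I_N])
      [set x : 'rV[R]_N | g j (x *m L) - x ord0 j = 0]); last first.
    apply/seteqP; split=> x /= gx H; apply: gx.
      apply/rowP => j; rewrite mxE; apply/eqP; rewrite -subr_eq0.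
      exact/eqP/H.
    move=> j _; apply/eqP; rewrite subr_eq0.
    by move/rowP/(_ j): H; rewrite mxE => /eqP.
  apply: measurableC; apply: fin_bigcap_measurable => // j _.
  apply: measurable_zeros; apply: measurable_continuous_rV.
  have [gC _ _] := gP j; have cg := lipschitz_continuous gC.
  move=> x; apply: (@continuousB _ _ _ (g j \o mulmx^~ L) (fun x => x ord0 j)).
    by apply: continuous_comp; [exact: continuous_mulmxr|exact: cg].
  exact: coord_continuous.
- apply/measurableC/measurableI => //.
  apply: measurable_closed; exact: closed_lipschitz_at.
(* Every point of [Y] is recovered, so failures lie in the complement of [Y]. *)
- move=> x /= gx Yx; apply: gx; apply/rowP => j; rewrite mxE.
  have [_ _ ->] := gP j; last by exists x.
  by rewrite /h pinv_f//; case: Yx.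
Qed.
End consequences.

Unset Implicit Arguments.
Set Strict Implicit.

Theorem corollary1p13 (R : realType) (N s k : nat)
  (s_gt0 : (0 < s)%N) (s_le_N : (s <= N)%N) (s_lt_k : (s < k)%N)
  (mu : {finite_measure set (borel_rV R N) -> \bar R})
  (mu_sparse : mu (~` @sparse R N s) = 0%E)
  (mu_cpt : compact (measure_support mu)) :
  ae_linear (fun L : 'M[R]_(N, k) =>
    exists X : set (borel_rV R N),
      [/\ measurable X,
          mu (~` X) = 0%E,
          set_inj X (fun x : 'rV[R]_N => x *m L) &
          forall alpha : R, 0 < alpha < 1 ->
            pointwise_holder alpha ((fun x : 'rV[R]_N => x *m L) @` X)
              (pinv X (fun x : 'rV[R]_N => x *m L))])
  /\
  ae_linear (fun L : 'M[R]_(N, k) =>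
    forall eps : R, 0 < eps -> forall alpha : R, 0 < alpha < 1 ->
      exists2 g : 'rV[R]_k -> 'rV[R]_N,
        holder alpha setT g &
        (mu [set x : 'rV[R]_N | g (x *m L) <> x] <= eps%:E)%E).
Proof.
have N_gt0 := leq_trans s_gt0 s_le_N.
rewrite sparseE// in mu_sparse.
have Bf (f : {f : {ffun 'I_s -> 'I_N} | injectiveb f}) :
    row_free (rowsub (val f) (1%:M : 'M[R]_N)).
  by apply: row_free_rowsub1; apply/injectiveP; exact: (valP f).
(* The set [X] obtained here does not depend on [alpha] or [eps] and serves both claims. *)
have H := ae_lipschitz_inverse Bf s_lt_k mu_sparse mu_cpt.
split; move: H; apply: filterS => v [X [mX muX [M M0 XM] XC]].
  exists X; split=> //; first exact: lipschitz_at_inj XC.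
  by move=> alpha a01; exact: (pointwise_holder_pinv N_gt0 M0 XM XC).
move=> eps eps0 alpha a01.
exact: (holder_recovery N_gt0 M0 XM XC mX muX a01 eps0).
Qed.
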